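(* Let $k$ and $n$ be integers, and let $\delta_n$ denote the decreasing permutation $n(n-1)\cdots 1$. Then the class $\mathrm{Av}(1\oplus\delta_n)$ admits the splitting $\{\mathrm{Av}(132)\}^{*k}$ (that is, every $(1\oplus\delta_n)$-avoiding permutation can have its entries colored by $k$ colors with no monochromatic occurrence of $132$) if and only if every $K_n$-free circle graph can be properly colored by $k$ colors. In particular, if $f(n)$ denotes the smallest integer such that $\mathrm{Av}(1\oplus\delta_n)$ admits the splitting $\{\mathrm{Av}(132)\}^{*f(n)}$, then $f(n)$ is equal to the largest chromatic number of $K_n$-free circle graphs.
   Context: A permutation of order $n\ge 1$ is a sequence of the $n$ distinct numbers of $[n]=\{1,\dots,n\}$. A permutation $\pi$ contains $\sigma$ if it has a subsequence order-isomorphic to $\sigma$ (an occurrence of $\sigma$); otherwise it avoids $\sigma$. $\mathrm{Av}(\sigma)$ is the set of all $\sigma$-avoiding permutations. For a permutation $\sigma$ of order $m$, $1\oplus\sigma$ is the permutation $1,\sigma(1)+1,\dots,\sigma(m)+1$. For permutation classes (sets of permutations closed under containment) $P_1,\dots,P_m$, the multiset $\{P_1,\dots,P_m\}$ is a splitting of a class $C$ (and $C$ is said to admit this splitting) if the entries of each permutation in $C$ can be colored by $m$ colors so that for each $i$ the subsequence of color $i$ is either empty or order-isomorphic to an element of $P_i$. $\mathcal S^{*k}$ denotes the multiset obtained from $\mathcal S$ by multiplying all multiplicities by $k$; thus $\{\mathrm{Av}(132)\}^{*k}$ consists of $k$ copies of $\mathrm{Av}(132)$. A matching on a set of $2q$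 points of the real line is a set of pairs (arcs) of the points such that each point is in exactly one pair; an arc with endpoints $a<b$ is written $(a,b)$. Two arcs $(a,b)$, $(c,d)$ cross if $a<c<b<d$ or $c<a<d<b$. The intersection graph of a matching has the arcs as vertices, two of them adjacent if and only if they cross. A circle graph is a graph that can be obtained as the intersection graph of a matching. A proper coloring of a graph is a coloring of its vertices in which no two adjacent vertices have the same color; the chromatic number is the smallest number of colors needed for a proper coloring. A graph is $K_n$-free if it has no complete subgraph on $n$ vertices. It is known that $\mathrm{Av}(1\oplus\delta_n)$ admits a splitting into finitely many copies of $\mathrm{Av}(132)$, so that $f(n)$ is well defined.
   Formalization: The equivalence excludes n=1, k=0, where it fails (the permutation 1 needs a color, but K_1-free graphs have no vertices), and the formula for f(n) assumes n≥2, since f(1)=1 while the largest chromatic number is 0, and no K_0-free graph exists. *)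

(* Defs.v *)
From HB Require Import structures.
From mathcomp Require Import all_boot all_order all_algebra finmap reals.

Set Implicit Arguments.
Unset Strict Implicit.
Unset Printing Implicit Defensive.

Import Order.TTheory GRing.Theory Num.Theory.

Definition is_permutation (s : seq nat) : bool :=
  (0 < size s) && perm_eq s (iota 1 (size s)).

Definition order_isomorphic (s t : seq nat) : Prop :=
  size s = size t /\
  forall i j, i < size s -> j < size s ->
    (nth 0 s i < nth 0 s j) = (nth 0 t i < nth 0 t j).

Definition contains (pi sigma : seq nat) : Prop :=
  exists2 s, subseq s pi & order_isomorphic s sigma.

Definition permset := seq nat -> Prop.

Definition Av (sigma : seq nat) : permset :=
  fun pi => is_permutation pi /\ ~ contains pi sigma.

Definition one_oplus (sigma : seq nat) : seq nat := 1 :: [seq x.+1 | x <- sigma].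

Definition delta (n : nat) : seq nat := rev (iota 1 n).

(** A multiset of permutation classes is encoded as a sequence. The entries of
    a permutation are distinct, so a coloring of the entries is a function of
    their values. *)
Definition admits_splitting (C : permset) (S : seq permset) : Prop :=
  forall pi, C pi ->
    exists2 c : nat -> nat,
      (forall x, x \in pi -> c x < size S) &
      forall i, i < size S ->
        let s := [seq x <- pi | c x == i] in
        s = [::] \/
        exists2 tau, nth (fun _ => False) S i tau & order_isomorphic s tau.

Definition multiset_mul (S : seq permset) (k : nat) : seq permset :=
  flatten (nseq k S).

Record sgraph := SGraph {
  vertex :> finType;
  edge : rel vertex;
  edge_sym : symmetric edge;
  edge_irr : irreflexive edge }.

Definition isomorphic (G H : sgraph) : Prop :=
  exists2 f : G -> H, bijective f & forall x y, edge (f x) (f y) = edge x y.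

Definition K_free (n : nat) (G : sgraph) : Prop :=
  ~ exists2 A : {set G}, #|A| = n &
      forall x y, x \in A -> y \in A -> x != y -> edge x y.

Definition colorable (k : nat) (G : sgraph) : bool :=
  [exists c : {ffun G -> 'I_k},
    [forall x, forall y, edge x y ==> (c x != c y)]].

Lemma colorable_exists (G : sgraph) : exists k, colorable k G.
Proof.
exists #|G|; apply/existsP; exists [ffun x => enum_rank x].
apply/forallP => x; apply/forallP => y; apply/implyP => exy.
rewrite !ffunE (inj_eq enum_rank_inj).
by apply: contraTneq exy => ->; rewrite edge_irr.
Qed.

Definition chromatic_number (G : sgraph) : nat := ex_minn (colorable_exists G).

(** Each arc is recorded with its smaller endpoint first. *)
Definition matching_on (R : realType) (P : {fset R}) (M : {fset R * R}) : Prop :=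
  (forall a, a \in M -> [/\ (a.1 < a.2)%R, a.1 \in P & a.2 \in P]) /\
  (forall p, p \in P -> exists! a, a \in M /\ (p = a.1 \/ p = a.2)).

Definition cross (R : realType) : rel (R * R) := fun x y =>
  let: (a, b) := x in let: (c, d) := y in
  [&& a < c, c < b & b < d]%R || [&& c < a, a < d & d < b]%R.

Definition arc_cross (R : realType) (M : {fset R * R}) : rel M := fun x y => cross (val x) (val y).

Lemma arc_cross_sym (R : realType) (M : {fset R * R}) : symmetric (@arc_cross R M).
Proof.
by move=> x y; rewrite /arc_cross /cross; case: (val x) (val y) => a b [c d]; rewrite orbC.
Qed.

Lemma arc_cross_irr (R : realType) (M : {fset R * R}) : irreflexive (@arc_cross R M).
Proof. by move=> x; rewrite /arc_cross /cross; case: (val x) => a b; rewrite ltxx. Qed.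

Definition intersection_graph (R : realType) (M : {fset R * R}) : sgraph :=
  SGraph (@arc_cross_sym R M) (@arc_cross_irr R M).

Definition circle_graph (R : realType) (G : sgraph) : Prop :=
  exists (P : {fset R}) (M : {fset R * R}),
    matching_on P M /\ isomorphic G (intersection_graph M).

Definition is_smallest (P : nat -> Prop) (m : nat) : Prop :=
  P m /\ forall j, P j -> m <= j.

Definition is_largest (P : nat -> Prop) (m : nat) : Prop :=
  P m /\ forall j, P j -> j <= m.

(* Main.v *)
(** A permutation is a point set in the plane. Give a point [t] that is not a
    left-to-right minimum the arc whose endpoints are its horizontal and vertical
    projections to the descending staircase through the left-to-right minima. Two
    arcs cross iff their points are the [32] of an occurrence of [132]; pairwise
    crossing arcs therefore have a common point below and to the left of them. So
    avoiding [one_oplus (delta n)] makes the circle graph [K_n]-free, and any proper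
    coloring of it, extended arbitrarily to the minima, leaves no monochromatic [132].

    Conversely, given arcs, realize them as points in this way, and place at each
    left endpoint, instead of a single left-to-right minimum, a copy of a permutation
    of the class that [k - 1] colors do not split (if there is none, use induction
    on [k]). Every copy then carries all [k] colors, so for any two crossing arcs of
    the same color, some point of a copy would complete a monochromatic [132]. *)

Require Import Defs.
From HB Require Import structures.
From mathcomp Require Import all_boot all_order all_algebra finmap reals.
From mathcomp Require Import zify.
From mathcomp Require boolp.

Set Implicit Arguments.
Unset Strict Implicit.
Unset Printing Implicit Defensive.

(** * Subsequences, patterns and standardization *)

Lemma order_isomorphic_sym (s t : seq nat) :
  order_isomorphic s t -> order_isomorphic t s.
Proof. by case=> st H; split=> // i j; rewrite -st => ? ?; rewrite H. Qed.

Lemma order_isomorphic_trans (s t u : seq nat) :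
  order_isomorphic s t -> order_isomorphic t u -> order_isomorphic s u.
Proof.
case=> st H [tu H']; split=> [|i j lti ltj]; first exact: etrans tu.
by rewrite H // H' -?st.
Qed.

(** Recording positions instead of entries lets an occurrence be transported along an order
    isomorphism. *)
Lemma subseq_nthP (s t : seq nat) :
  subseq t s <->
  exists l, [/\ sorted ltn l, all (gtn (size s)) l & t = [seq nth 0 s i | i <- l]].
Proof.
have sE : [seq nth 0 s i | i <- iota 0 (size s)] = s by apply: mkseq_nth.
split=> [| [l [lS /allP ls ->]]].
  rewrite -{1}sE => /subseqP[m sm ->].
  exists (mask m (iota 0 (size s))); split; last by rewrite map_mask.
    exact: (subseq_sorted ltn_trans (mask_subseq _ _) (iota_ltn_sorted _ _)).
  by apply/allP => i /mem_mask; rewrite mem_iota.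
rewrite -[X in subseq _ X]sE; apply: map_subseq.
suff -> : l = [seq i <- iota 0 (size s) | i \in l] by apply: filter_subseq.
apply: (irr_sorted_eq ltn_trans ltnn) => //.
  exact/(sorted_filter ltn_trans)/iota_ltn_sorted.
move=> i; rewrite mem_filter mem_iota /=.
by case: (boolP (i \in l)) => // /ls /= ->.
Qed.

Lemma contains_order_isomorphic (s t sigma : seq nat) :
  order_isomorphic s t -> contains s sigma -> contains t sigma.
Proof.
case=> st H [_ /subseq_nthP[l [lS ls ->]] iso].
exists [seq nth 0 t i | i <- l].
  by apply/subseq_nthP; exists l; rewrite -st.
apply: order_isomorphic_trans iso; apply: order_isomorphic_sym.
split; rewrite !size_map // => i j li lj.
rewrite !(nth_map 0) //.
by move/all_nthP: ls => ls; rewrite H //; apply: ls.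
Qed.

Lemma contains132P (s : seq nat) :
  contains s [:: 1; 3; 2] <->
  exists x y z, subseq [:: x; y; z] s /\ x < z < y.
Proof.
split=> [[t ts [st H]] | [x [y [z [sub /andP[xz zy]]]]]].
  case: t st ts H => [|x [|y [|z [|]]]] //= _ sub H.
  exists x, y, z; split=> //.
  by move: (H 0 2 isT isT) (H 2 1 isT isT) => /= -> ->.
exists [:: x; y; z] => //; split=> //.
by move=> [|[|[|i]]] [|[|[|j]]] //= _ _; lia.
Qed.

(** Each entry becomes its rank in the sorted sequence, shifted by one because values start at
    [1]. *)
Lemma standardization (s : seq nat) : uniq s -> s != [::] ->
  exists2 t, is_permutation t & order_isomorphic s t.
Proof.
move=> us s0; pose g x := index x (sort leq s).
have g_lt x y : x \in s -> y \in s -> (x < y) = (g x < g y).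
  have sS : sorted leq (sort leq s) by apply: sort_sorted leq_total _.
  have idx := sorted_leq_index leq_trans leqnn sS.
  have ms a : (a \in sort leq s) = (a \in s) by rewrite mem_sort.
  move=> sx sy; apply/idP/idP; rewrite !ltnNge; apply: contra => xy.
    by apply: idx xy; rewrite ms.
  rewrite leqNgt; apply/negP => lt_xy.
  have xy' : x <= y by apply: idx; rewrite ?ms // ltnW.
  by move: lt_xy; rewrite [x](@anti_leq x y) ?ltnn // xy xy'.
exists [seq (g x).+1 | x <- s]; last first.
  split; rewrite ?size_map // => i j li lj.
  by rewrite !(nth_map 0) // ltnS -g_lt ?mem_nth.
rewrite /is_permutation size_map lt0n size_eq0 s0 /=.
have ut : uniq [seq (g x).+1 | x <- s].
  rewrite map_inj_in_uniq // => x y sx sy [gxy].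
  by case: (ltngtP x y) => //; rewrite g_lt // gxy ltnn.
apply: uniq_perm; rewrite ?iota_uniq //.
(* Distinct values inside [1..size s] exhaust that interval, by counting. *)
apply: (uniq_min_size ut _ _).2; rewrite ?size_iota ?size_map //.
move=> _ /mapP[x sx ->]; rewrite mem_iota /= ltnS.
by rewrite -[ltnRHS](size_sort leq) index_mem mem_sort.
Qed.

(** * Point configurations and their translation into permutations *)

(** Points [t] of a finite set, with coordinates [X t] and [Y t]; a permutation
    is the case [T = 'I_n], [X = val]. The two predicates below are avoidance of
    [one_oplus (delta n)] and splittability into [k] copies of [Av 132]. *)
Definition avoids (T : finType) (X Y : T -> nat) (n : nat) : Prop :=
  forall (a : T) (A : {set T}),
    (forall x, x \in A -> X a < X x /\ Y a < Y x) ->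
    {in A &, forall x y, X x < X y -> Y y < Y x} -> #|A| <> n.

Definition splits (T : finType) (X Y : T -> nat) (k : nat) : Prop :=
  exists c : T -> 'I_k, forall x y z,
    X x < X y < X z -> Y x < Y z < Y y -> c x = c y -> c y <> c z.

Lemma splits_dec (T : finType) (X Y : T -> nat) (k : nat) :
  decidable (splits X Y k).
Proof.
pose P (c : {ffun T -> 'I_k}) := [forall x, forall y, forall z,
  (X x < X y < X z) && (Y x < Y z < Y y) && (c x == c y) ==> (c y != c z)].
apply: (@decP _ [exists c, P c]); apply: (iffP existsP) => [[c Pc] | [c Pc]].
  exists c => x y z hX hY /eqP cxy; move: Pc => /forallP/(_ x)/forallP/(_ y).
  by move/forallP/(_ z); rewrite hX hY cxy => /eqP.
exists [ffun x => c x]; apply/forallP=> x; apply/forallP=> y; apply/forallP=> z.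
apply/implyP => /andP[/andP[hX hY]]; rewrite !ffunE => /eqP cxy.
exact/eqP/(Pc x y z).
Qed.

Lemma nth_delta (n j : nat) : j < n -> nth 0 (delta n) j = n - j.
Proof. by move=> jn; rewrite nth_rev size_iota // nth_iota; lia. Qed.

(** In an occurrence, [a] is the position of the entry [1] and [A] the set of positions of the
    decreasing part, listed from left to right by [l]. *)
Lemma contains_one_oplus_deltaP (s : seq nat) (n : nat) :
  ~ contains s (one_oplus (delta n)) <->
  avoids (val : 'I_(size s) -> nat) (fun i => nth 0 s i) n.
Proof.
have sz : size (one_oplus (delta n)) = n.+1.
  by rewrite /= size_map size_rev size_iota.
have nS j : j < n -> nth 0 (one_oplus (delta n)) j.+1 = (n - j).+1.
  by move=> jn; rewrite /= (nth_map 0) ?size_rev ?size_iota ?nth_delta.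
split=> [av a A lA dA cA | av [t /subseq_nthP[l [lS ls ->]] [szl iso]]].
  apply: av; set l := [seq val i | i in A].
  have szl : size l = n by rewrite size_map -cardE.
  have lS : sorted ltn l.
    apply: (subseq_sorted ltn_trans _ (iota_ltn_sorted 0 (size s))).
    by rewrite -val_enum_ord map_subseq // enumT filter_subseq.
  have memA j : j < n -> exists2 i, i \in A & nth 0 l j = val i.
    move=> jn; have : nth 0 l j \in l by rewrite mem_nth ?szl.
    by case/mapP => i; rewrite mem_enum; exists i.
  exists [seq nth 0 s i | i <- val a :: l].
    apply/subseq_nthP; exists (val a :: l); split=> //.
      rewrite /= path_min_sorted // all_map; apply/allP => i.
      by rewrite mem_enum /= => /lA[].
    rewrite /= ltn_ord all_map; apply/allP => i _ /=; exact: ltn_ord.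
  split; rewrite size_map ?sz /= ?szl // => i j.
  have lt_nth j1 j2 : j1 < j2 -> j2 < n -> nth 0 l j1 < nth 0 l j2.
    move=> j12 j2n; rewrite (sorted_ltn_nth ltn_trans) // inE szl; lia.
  case: i j => [|i] [|j]; rewrite ?ltnS => hi hj.
  - by rewrite !ltnn.
  - rewrite nS //= (nth_map 0) ?szl //.
    by have [x /lA[_ /= ax] ->] := memA _ hj; rewrite ax; lia.
  - rewrite nS //= (nth_map 0) ?szl //.
    by have [x /lA[_ /= ax] ->] := memA _ hi; apply/negP/negP; lia.
  - rewrite !nS //= !(nth_map 0) ?szl //.
    have [x Ax ex] := memA _ hi; have [y Ay ey] := memA _ hj.
    case: (ltngtP i j) => ij.
    + have := lt_nth _ _ ij hj; rewrite ex ey => /(dA _ _ Ax Ay) /=; lia.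
    + have := lt_nth _ _ ij hi; rewrite ex ey => /(dA _ _ Ay Ax) /= ->; lia.
    + by rewrite ij !ltnn.
case: l lS ls szl iso => [|a l]; first by rewrite sz.
rewrite sz size_map /= => lS /andP[ltas /allP ls] [szl]; rewrite szl => iso.
apply: (av (Ordinal ltas) [set i | val i \in l]).
- move=> x; rewrite inE => lx.
  split; first exact: (allP (order_path_min ltn_trans lS)).
  have jn : index (val x) l < n by rewrite -szl index_mem.
  have := iso 0 (index (val x) l).+1 isT jn.
  by rewrite nS //= (nth_map 0) ?szl // nth_index // ltnS subn_gt0 jn => ->.
- move=> x y; rewrite !inE => lx ly /= xy.
  have hx : index (val x) l < n by rewrite -szl index_mem.
  have hy : index (val y) l < n by rewrite -szl index_mem.
  have := iso (index (val y) l).+1 (index (val x) l).+1 hy hx.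
  rewrite !nS //= !(nth_map 0) ?szl // !nth_index // => ->.
  suff lt_xy : index (val x) l < index (val y) l by rewrite ltnS ltn_sub2l.
  have idx := sorted_ltn_index ltn_trans (path_sorted lS) _ _ ly lx.
  case: (ltngtP (index (val x) l) (index (val y) l)) => // [/idx|e].
    by rewrite ltnNge ltnW.
  by move: xy; rewrite -(nth_index 0 lx) -(nth_index 0 ly) e ltnn.
- have ul : uniq l by apply: (sorted_uniq ltn_trans ltnn); apply: path_sorted lS.
  have /card_uniqP ca : uniq (pmap (insub : _ -> option 'I_(size s)) l).
    exact: pmap_sub_uniq.
  rewrite -szl -[RHS](count_predT l).
  rewrite -(eq_in_count (a1 := isSome \o (insub : _ -> option 'I_(size s)))).
    rewrite -size_pmap -ca; apply: eq_card => i.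
    by rewrite inE mem_pmap_sub.
  by move=> j /ls /= ltj; rewrite insubT.
Qed.

Lemma permutation_uniq (pi : seq nat) : is_permutation pi -> uniq pi.
Proof. by case/andP=> _ /perm_uniq ->; apply: iota_uniq. Qed.

Lemma nth_multiset_mul (P : permset) (k i : nat) (Q : permset) :
  i < k -> nth Q (multiset_mul [:: P] k) i = P.
Proof. by elim: k i => // k IHk [|i] //= ik; apply: IHk. Qed.

Lemma size_multiset_mul (P : permset) (k : nat) :
  size (multiset_mul [:: P] k) = k.
Proof. by elim: k => //= k ->. Qed.

(** One side colors values, the other positions; the entries being distinct, the two colorings
    determine each other. Nonempty color classes are standardized to get members of the class. *)
Lemma permutation_splitting (pi : seq nat) (k : nat) : is_permutation pi ->
  (exists2 c : nat -> nat,
      (forall x, x \in pi -> c x < size (multiset_mul [:: Av [:: 1; 3; 2]] k)) &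
      forall i, i < size (multiset_mul [:: Av [:: 1; 3; 2]] k) ->
        let s := [seq x <- pi | c x == i] in
        s = [::] \/
        exists2 tau, nth (fun _ => False) (multiset_mul [:: Av [:: 1; 3; 2]] k) i tau
                   & order_isomorphic s tau)
  <-> splits (val : 'I_(size pi) -> nat) (fun i => nth 0 pi i) k.
Proof.
move=> /permutation_uniq upi; rewrite size_multiset_mul.
split=> [[c ck cP] | [c cP]].
  have ck' (i : 'I_(size pi)) : c (nth 0 pi i) < k by apply/ck/mem_nth.
  exists (fun i => Ordinal (ck' i)) => x y z /= /andP[xy yz] /andP[hxz hzy].
  move=> [cxy] [cyz].
  have := cP _ (ck' x); rewrite nth_multiset_mul // => -[s0|[tau [_ avtau] iso]].
    have : nth 0 pi x \in [::] by rewrite -s0 mem_filter eqxx mem_nth.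
    by [].
  apply: avtau; apply: contains_order_isomorphic iso _.
  apply/contains132P; exists (nth 0 pi x), (nth 0 pi y), (nth 0 pi z).
  split; last by rewrite hxz hzy.
  rewrite subseq_filter /= -cyz -cxy !eqxx /=; apply/subseq_nthP.
  by exists [:: val x; val y; val z]; rewrite /= xy yz !ltn_ord.
pose col x := if insub (index x pi) is Some i then val (c i) else 0.
have colE (i : 'I_(size pi)) : col (nth 0 pi i) = c i.
  by rewrite /col index_uniq // valK.
have col_lt x : x \in pi -> col x < k.
  rewrite -index_mem => xpi; rewrite /col insubT; apply: ltn_ord.
exists col => // i ik s; case: (eqVneq s [::]) => [|s0]; first by left.
right; have us : uniq s by apply: filter_uniq.
have [tau ptau iso] := standardization us s0; exists tau => //.
rewrite nth_multiset_mul //; split=> // tau132.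
have /contains132P := contains_order_isomorphic (order_isomorphic_sym iso) tau132.
move=> [x [y [z [sub xzy]]]]; move: sub; rewrite subseq_filter => /andP[/=].
move=> /and4P[/eqP cx /eqP cy /eqP cz _] /subseq_nthP[l []].
case: l => [|jx [|jy [|jz []]]] //= /and3P[xy yz _] /and4P[lx ly lz _] [ex ey ez].
apply: (cP (Ordinal lx) (Ordinal ly) (Ordinal lz)); rewrite /= -?ex -?ey -?ez.
- by rewrite xy yz.
- by [].
- by apply: val_inj; rewrite /= -!colE /= -ex -ey cx cy.
- by apply: val_inj; rewrite /= -!colE /= -ez -ey cz cy.
Qed.

(** List the points by increasing [X] and standardize the resulting sequence of heights. *)
Lemma configuration_permutation (T : finType) (X Y : T -> nat) :
  injective X -> injective Y -> 0 < #|T| ->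
  exists pi (h : T -> 'I_(size pi)),
    [/\ is_permutation pi, bijective h,
        forall x y, (h x < h y) = (X x < X y) &
        forall x y, (nth 0 pi (h x) < nth 0 pi (h y)) = (Y x < Y y)].
Proof.
move=> Xi Yi T0; pose r := relpre X leq; pose s := sort r (enum T).
have [rT rR rA] : [/\ transitive r, reflexive r & total r].
  split=> [y x z|x|x y]; [exact: leq_trans|exact: leqnn|exact: leq_total].
have us : uniq s by rewrite sort_uniq enum_uniq.
have ms x : x \in s by rewrite mem_sort mem_enum.
have szs : size s = #|T| by rewrite size_sort -cardE.
have [||pi ppi [szpi iso]] := @standardization [seq Y x | x <- s].
- by rewrite map_inj_uniq.
- by rewrite -size_eq0 size_map szs -lt0n.
rewrite size_map in szpi iso.
have hP x : index x s < size pi by rewrite -szpi index_mem.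
exists pi, (fun x => Ordinal (hP x)); split=> //.
- apply: inj_card_bij => [x y [exy]|]; last by rewrite card_ord -szpi szs.
  by rewrite -(nth_index x (ms x)) exy nth_index.
- move=> x y /=; have idx := sorted_leq_index rT rR (sort_sorted rA _).
  apply/idP/idP; rewrite !ltnNge; apply: contra => xy.
    case: (ltngtP (index x s) (index y s)) => // lt_xy.
    have /Xi e : X x = X y.
      apply: anti_leq; rewrite xy andbT.
      exact: idx (ms x) (ms y) (ltnW lt_xy).
    by rewrite e ltnn in lt_xy.
  exact: idx (ms y) (ms x) xy.
- move=> x y /=; rewrite -iso ?index_mem //.
  by rewrite !(nth_map x) ?index_mem // !nth_index.
Qed.

(** Permutations have order at least [1], so the empty configuration is treated apart; the empty
    coloring works even for [k = 0]. *)
Lemma splits_empty (T : finType) (X Y : T -> nat) (k : nat) :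
  #|T| = 0 -> splits X Y k.
Proof.
move=> T0; have T' (x : T) : False by have := fintype0 x; rewrite T0 => /(_ erefl).
by exists (fun x => False_rect _ (T' x)) => x; case: (T' x).
Qed.

Lemma admits_splittingP (n k : nat) :
  admits_splitting (Av (one_oplus (delta n)))
                   (multiset_mul [:: Av [:: 1; 3; 2]] k) <->
  forall (T : finType) (X Y : T -> nat), injective X -> injective Y ->
    avoids X Y n -> splits X Y k.
Proof.
split=> [sp T X Y Xi Yi av | sp pi [ppi /contains_one_oplus_deltaP av]]; last first.
  apply/permutation_splitting => //; apply: sp av => [|i j]; first exact: val_inj.
  move/eqP; rewrite nth_uniq ?permutation_uniq // => /eqP; exact: val_inj.
case: (posnP #|T|) => [T0|T0]; first exact: splits_empty.
have [pi [h [ppi [g hK gK] hX hY]]] := configuration_permutation Xi Yi T0.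
have /sp/permutation_splitting : Av (one_oplus (delta n)) pi.
  split=> //; apply/contains_one_oplus_deltaP => a A lA dA.
  rewrite -(card_imset A (can_inj gK)); apply: (av (g a)).
    by move=> _ /imsetP[x Ax ->]; rewrite -hX -hY !gK; apply: lA.
  move=> _ _ /imsetP[x Ax ->] /imsetP[y Ay ->].
  by rewrite -hX -hY !gK; apply: dA.
move=> /(_ ppi)[c cP]; exists (c \o h) => x y z.
by rewrite -!hX -!hY => hXs hYs; apply: cP.
Qed.

(** * Circle graphs with natural numbers as endpoints *)

Definition crossing (V : Type) (l r : V -> nat) : rel V := fun x y =>
  [&& l x < l y, l y < r x & r x < r y] || [&& l y < l x, l x < r y & r y < r x].

Lemma order_rank (R : realType) (P : {fset R}) : exists rk : R -> nat,
  {in P &, forall p q, (rk p < rk q) = (p < q)%R}.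
Proof.
pose rk (p : R) := #|[set q : P | (val q < p)%R]|; exists rk.
have rk_le p q : (p <= q)%R -> rk p <= rk q.
  move=> pq; apply/subset_leq_card/subsetP => z; rewrite !inE => zp.
  exact: Order.POrderTheory.lt_le_trans pq.
move=> p q Pp Pq; case: (Order.TotalTheory.ltP p q) => [pq|/rk_le]; last first.
  by rewrite leqNgt => /negbTE.
apply/proper_card/properP; split.
  apply/subsetP => z; rewrite !inE => zp; exact: Order.POrderTheory.lt_trans pq.
by exists [` Pp]%fset; rewrite !inE //= Order.POrderTheory.ltxx.
Qed.

(** Crossing depends only on the order of the endpoints, so ranks can replace real numbers;
    conversely, naturals embed into [R]. *)
Lemma circle_graphP (R : realType) (G : sgraph) :
  circle_graph R G <->
  exists l r : G -> nat,
    [/\ injective l, injective r, forall x y, l x <> r y, forall x, l x < r x &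
        forall x y, edge x y = crossing l r x y].
Proof.
split=> [[P [M [[arcM uniqM] [f fB fE]]]] | [l [r [li ri lr lltr lrE]]]].
  have [rk rkE] := order_rank P.
  have fM x : [/\ ((val (f x)).1 < (val (f x)).2)%R,
      (val (f x)).1 \in P & (val (f x)).2 \in P] by apply/arcM/valP.
  (* Arcs sharing an endpoint coincide, since each point of [P] is on exactly one arc. *)
  have f_uniq x y p : p \in P -> p = (val (f x)).1 \/ p = (val (f x)).2 ->
      p = (val (f y)).1 \/ p = (val (f y)).2 -> x = y.
    move=> /uniqM[a [_ aU]] px py; apply/(bij_inj fB)/val_inj.
    by rewrite -(aU (val (f x))) ?(aU (val (f y))) //; split=> //; apply: valP.
  have rk_inj p q : p \in P -> q \in P -> rk p = rk q -> p = q.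
    move=> Pp Pq e; case: (Order.TotalTheory.ltgtP p q) => //; rewrite -rkE //.
      by rewrite e ltnn.
    by rewrite e ltnn.
  exists (fun x => rk (val (f x)).1), (fun x => rk (val (f x)).2); split.
  - move=> x y; have [_ Px _] := fM x; have [_ Py _] := fM y.
    by move/(rk_inj _ _ Px Py) => e; apply: (f_uniq _ _ _ Px); left.
  - move=> x y; have [_ _ Px] := fM x; have [_ _ Py] := fM y.
    by move/(rk_inj _ _ Px Py) => e; apply: (f_uniq _ _ _ Px); right.
  - move=> x y; have [ltx Px _] := fM x; have [_ _ Py] := fM y.
    move/(rk_inj _ _ Px Py) => e.
    have xy : x = y by apply: (f_uniq _ _ _ Px); [left|right].
    by move: ltx; rewrite e xy Order.POrderTheory.ltxx.
  - by move=> x; have [ltx Px Px'] := fM x; rewrite rkE.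
  - move=> x y; rewrite -fE /= /arc_cross /cross /crossing.
    have [_ Px Px'] := fM x; have [_ Py Py'] := fM y.
    by rewrite !rkE //; case: (f x) (f y) => [[? ?] ?] [[? ?] ?].
pose arc x : R * R := ((l x)%:R, (r x)%:R)%R.
have natr_eq (m n : nat) : (m%:R = n%:R :> R)%R -> m = n.
  by move/eqP; rewrite Num.Theory.eqr_nat => /eqP.
pose M := [fset arc x | x in G]%fset.
pose P := ([fset (arc x).1 | x in G] `|` [fset (arc x).2 | x in G])%fset.
have arcM x : arc x \in M by apply/imfsetP; exists x.
have arc_inj : injective arc by move=> x y [/natr_eq/li].
exists P, M; split; first split.
- move=> _ /imfsetP[x _ ->]; rewrite /= Num.Theory.ltr_nat lltr; split=> //.
    by apply/fsetUP; left; apply/imfsetP; exists x.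
  by apply/fsetUP; right; apply/imfsetP; exists x.
- move=> p /fsetUP[] /imfsetP[x _ ->]; exists (arc x); split.
  + by split; [|left].
  + move=> _ [/imfsetP[y _ ->]] [] /= /natr_eq; first by move/li->.
    by move/lr.
  + by split; [|right].
  + move=> _ [/imfsetP[y _ ->]] [] /= /natr_eq; last by move/ri->.
    by move/esym/lr.
exists (fun x => [` arcM x]%fset).
  apply: inj_card_bij => [x y [/natr_eq/li //]|].
  rewrite -cardfE; apply: leq_trans (leq_imfset_card _ _ _) _.
  by rewrite cardE.
by move=> x y; rewrite lrE /= /arc_cross /= /crossing !Num.Theory.ltr_nat.
Qed.

(** Such sums encode pairs in lexicographic order: [a] selects a block of length [K], and [b] a
    place in it. *)
Lemma ltn_block (K a b c d : nat) : b < K -> d < K ->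
  (a * K + b < c * K + d) = (a < c) || (a == c) && (b < d).
Proof.
move=> bK dK; case: (ltngtP a c) => [ac|ca|->] /=; last by rewrite ltn_add2l.
  by have := leq_mul2r K a.+1 c; rewrite ac orbT mulSn; lia.
by have := leq_mul2r K c.+1 a; rewrite ca orbT mulSn; lia.
Qed.

Lemma block_inj (K a b c d : nat) : b < K -> d < K ->
  a * K + b = c * K + d -> a = c /\ b = d.
Proof.
move=> bK dK e; have := ltn_block a c bK dK; have := ltn_block c a dK bK.
by rewrite e ltnn; lia.
Qed.

Lemma colorableP (k : nat) (G : sgraph) :
  reflect (exists c : G -> 'I_k, forall x y, edge x y -> c x <> c y)
          (colorable k G).
Proof.
apply: (iffP existsP) => [[c /forallP cP] | [c cP]].
  by exists c => x y xy; apply/eqP; move/forallP/(_ y)/implyP: (cP x); apply.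
exists [ffun x => c x]; apply/forallP => x; apply/forallP => y; apply/implyP.
by move/cP; rewrite !ffunE => /eqP.
Qed.

Lemma colorable_leq (k m : nat) (G : sgraph) :
  k <= m -> colorable k G -> colorable m G.
Proof.
move=> km /colorableP[c cP]; apply/colorableP; exists (widen_ord km \o c).
by move=> x y /cP cxy [e]; apply: cxy; apply: val_inj.
Qed.

(** * From splittings to colorings: the blow-up of a configuration *)

(** The arc [v] becomes the point [(v, None)], and [v] also gets a copy of the
    configuration [X0, Y0], whose points are the [(v, Some t)]. The copies descend
    from left to right in the order of the left endpoints, and the copy at [v]
    lies below and to the left of [(u, None)] iff [l u <= l v < r u]. *)
Section Blowup.
Variables (V T0 : finType) (l r : V -> nat) (X0 Y0 : T0 -> nat).

(** Subtraction from [N] turns left endpoints into decreasing heights. The block length [K] serves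
    both coordinates: its last offset [K.-1], reserved for arc points, exceeds all offsets inside a
    copy. *)
Let N := \max_v l v.
Let K := (\max_t (X0 t + Y0 t)).+2.

Definition blowup_offset (Z : T0 -> nat) (o : option T0) :=
  if o is Some t then Z t else K.-1.

Definition blowup_X (p : V * option T0) :=
  (if p.2 is Some _ then l p.1 else r p.1) * K + blowup_offset X0 p.2.

Definition blowup_Y (p : V * option T0) :=
  (N - l p.1) * K + blowup_offset Y0 p.2.

Hypotheses (l_inj : injective l) (r_inj : injective r)
  (lr : forall x y, l x <> r y) (ltlr : forall x, l x < r x)
  (X0_inj : injective X0) (Y0_inj : injective Y0).

Let leN v : l v <= N. Proof. exact: leq_bigmax. Qed.

Let leK t : X0 t + Y0 t < K.-1.
Proof. by rewrite ltnS; apply: (leq_bigmax (F := fun t => X0 t + Y0 t)). Qed.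

Let ltX t : X0 t < K.-1. Proof. by have := leK t; lia. Qed.
Let ltY t : Y0 t < K.-1. Proof. by have := leK t; lia. Qed.

Let offX o : blowup_offset X0 o < K.
Proof. by case: o => [t|] //=; apply: ltn_trans (ltX t) _. Qed.
Let offY o : blowup_offset Y0 o < K.
Proof. by case: o => [t|] //=; apply: ltn_trans (ltY t) _. Qed.

Lemma blowup_X_inj : injective blowup_X.
Proof.
case=> [v o] [u o'] /block_inj[] //=; case: o o' => [t|] [t'|] //=.
- by move/l_inj-> => /X0_inj ->.
- by move/lr.
- by move/esym/lr.
- by move/r_inj->.
Qed.

Lemma blowup_Y_inj : injective blowup_Y.
Proof.
case=> [v o] [u o'] /block_inj[] //= e.
have /l_inj -> : l v = l u by have := leN v; have := leN u; lia.
case: o o' => [t|] [t'|] //=; first by move/Y0_inj ->.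
- by move=> e'; have := ltY t; rewrite e' ltnn.
- by move=> e'; have := ltY t'; rewrite -e' ltnn.
Qed.

Lemma ltn_blowup_X (v u : V) (o o' : option T0) :
  (blowup_X (v, o) < blowup_X (u, o')) =
  match o, o' with
  | Some t, Some t' => (l v < l u) || (v == u) && (X0 t < X0 t')
  | Some t, None => l v < r u
  | None, Some t => r v < l u
  | None, None => r v < r u
  end.
Proof.
rewrite ltn_block //=; case: o o' => [t|] [t'|] /=.
- by rewrite (inj_eq l_inj).
- by rewrite (introF eqP (@lr v u)) orbF.
- by rewrite eq_sym (introF eqP (@lr u v)) orbF.
- by rewrite ltnn andbF orbF.
Qed.

Lemma ltn_blowup_Y (v u : V) (o o' : option T0) :
  (blowup_Y (v, o) < blowup_Y (u, o')) =
  (l u < l v) || (v == u) &&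
  match o, o' with
  | Some t, Some t' => Y0 t < Y0 t'
  | Some t, None => true
  | None, _ => false
  end.
Proof.
rewrite ltn_block //=.
have -> : (N - l v < N - l u) = (l u < l v).
  by have := leN v; have := leN u; lia.
have -> : (N - l v == N - l u) = (v == u).
  by rewrite -(inj_eq l_inj); have := leN v; have := leN u; lia.
congr (_ || _ && _); case: o o' => [t|] [t'|] /=; rewrite ?ltY ?ltnn //.
by apply/negbTE; rewrite -leqNgt ltnW.
Qed.

(** If [A] meets a copy, it lies inside the copy containing [a], and avoidance by [X0, Y0] applies.
    Otherwise [A] consists of arc points whose arcs all contain [l v]; as [A] is decreasing, these
    arcs cross pairwise. *)
Lemma blowup_avoids (n : nat) : avoids X0 Y0 n ->
  (forall A : {set V}, {in A &, forall x y, x != y -> crossing l r x y} ->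
     #|A| <> n) ->
  avoids blowup_X blowup_Y n.
Proof.
move=> av0 avG [v o] A lA dA.
have memS u t : (u, Some t) \in A -> [/\ o <> None, u = v & forall w, (w, None) \notin A].
  move=> Aut; have [] := lA _ Aut; rewrite ltn_blowup_X ltn_blowup_Y.
  case: o lA => [t0|] lA; last first.
    by rewrite andbF orbF => rl ll; have := ltlr v; lia.
  move=> hX hY; have uv : u = v.
    by apply: l_inj; move: hX hY; rewrite -!(inj_eq l_inj); lia.
  (* An arc point above and to the right of [a] is above and to the right of the whole copy at [v],
     so it cannot be in a decreasing set with a point of that copy. *)
  split=> // w; apply/negP => Aw.
  have [] := lA _ Aw; rewrite ltn_blowup_X ltn_blowup_Y => hX' hY'.
  have := dA _ _ Aut Aw; rewrite ltn_blowup_X ltn_blowup_Y uv => /(_ hX').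
  by rewrite andbF orbF; move: hY'; rewrite -(inj_eq l_inj); lia.
case: (pickP (fun p : V * T0 => (p.1, Some p.2) \in A)) => [[u t] /= Aut|noS].
  have [oN uv noN] := memS _ _ Aut; case: o oN => [t0|//] _ in lA memS *.
  pose B := [set t | (v, Some t) \in A].
  have -> : A = [set (v, Some t) | t in B].
    apply/setP => -[w [t'|]]; apply/idP/imsetP => [Aw|[t'' Bt [-> e]]].
    - have [_ wv _] := memS _ _ Aw.
      by exists t'; rewrite ?inE -?wv.
    - by rewrite inE -e in Bt *.
    - by rewrite (negPf (noN w)) in Aw.
    - by [].
  rewrite card_imset; last by move=> ? ? [].
  apply: (av0 t0 B) => [x|x y]; rewrite !inE.
    by move/lA; rewrite ltn_blowup_X ltn_blowup_Y !ltnn eqxx.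
  move=> Ax Ay; have := dA _ _ Ax Ay.
  by rewrite ltn_blowup_X ltn_blowup_Y !ltnn eqxx.
pose B := [set u | (u, None : option T0) \in A].
have -> : A = [set (u, None) | u in B].
  apply/setP => -[w [t'|]]; apply/idP/imsetP => [Aw|[w' Bw [-> //]]].
  - by have := noS (w, t'); rewrite /= Aw.
  - by exists w; rewrite ?inE.
  - by rewrite inE in Bw.
rewrite card_imset; last by move=> ? ? [].
apply: avG.
(* Height gives [l x <= l v] and position gives [l v < r y], also when [a] is itself an arc
   point. *)
have l_lt_r x y : x \in B -> y \in B -> l x < r y.
  rewrite !inE => /lA[_ hx] /lA[hy _]; move: hx hy (ltlr v).
  rewrite ltn_blowup_X ltn_blowup_Y -(inj_eq l_inj).
  by case: (o) => [?|]; lia.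
have B_cross x y : x \in B -> y \in B -> r x < r y -> crossing l r x y.
  move=> Bx By rxy; have := l_lt_r _ _ By Bx; move: Bx By; rewrite !inE => Ax Ay lyx.
  have := dA _ _ Ax Ay; rewrite ltn_blowup_X ltn_blowup_Y andbF orbF.
  by move=> /(_ rxy) lxy; apply/orP; left; apply/and3P.
move=> x y Bx By xy; case: (ltngtP (r x) (r y)) => [|ryx|/r_inj e].
- exact: B_cross.
- by rewrite /crossing orbC; apply: B_cross.
- by rewrite e eqxx in xy.
Qed.

(* If the copy of the hard configuration at [v] missed a color, the copy would
   be split by the remaining [k] colors. *)
Lemma blowup_splits (k : nat) : ~ splits X0 Y0 k ->
  splits blowup_X blowup_Y k.+1 ->
  exists c : V -> 'I_k.+1, forall x y, crossing l r x y -> c x <> c y.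
Proof.
move=> nsp [c cP].
have all_colors v i : exists t, c (v, Some t) = i.
  case: (pickP (fun t => c (v, Some t) == i)) => [t /eqP|no]; first by exists t.
  case: nsp; have /fin_all_exists[c' c'E] t : exists j, c (v, Some t) = lift i j.
    have : i != c (v, Some t) by rewrite eq_sym no.
    by case/unlift_some => j ->; exists j.
  exists c' => x y z hX hY exy eyz.
  apply: (cP (v, Some x) (v, Some y) (v, Some z)).
  - by rewrite !ltn_blowup_X !ltnn eqxx.
  - by rewrite !ltn_blowup_Y !ltnn eqxx.
  - by rewrite !c'E exy.
  - by rewrite !c'E eyz.
have c_cross x y : [&& l x < l y, l y < r x & r x < r y] ->
    c (x, None) <> c (y, None).
  (* The copy point [t] at [y], the arc point of [x] and the arc point of [y] form a [132] whose
     first two points share a color. *)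
  move=> /and3P[lxy lyx rxy]; have [t ct] := all_colors y (c (x, None)).
  apply: (cP (y, Some t)) => //; first by rewrite !ltn_blowup_X lyx.
  by rewrite !ltn_blowup_Y !ltnn eqxx lxy.
exists (fun v => c (v, None)) => x y /orP[/c_cross //|/c_cross yx /esym //].
Qed.

End Blowup.

Lemma splits_colorable (n k : nat) (G : sgraph) (l r : G -> nat) :
  injective l -> injective r -> (forall x y, l x <> r y) ->
  (forall x, l x < r x) -> (forall x y, edge x y = crossing l r x y) ->
  K_free n G ->
  (forall (T : finType) (X Y : T -> nat), injective X -> injective Y ->
     avoids X Y n -> splits X Y k) ->
  colorable k G.
Proof.
move=> li ri lr lltr lrE Gn.
have avG (A : {set G}) : {in A &, forall x y, x != y -> crossing l r x y} ->
    #|A| <> n.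
  by move=> cA An; apply: Gn; exists A => // x y Ax Ay; rewrite lrE; apply: cA.
elim: k => [|k IHk] sp.
  (* A single point rules out [k = 0]. It avoids the pattern because [n] is nonzero, the empty set
     being a clique of size [0]. *)
  have [||| c _] := sp unit (fun=> 0) (fun=> 0); last by case: (c tt).
  - by move=> [] [].
  - by move=> [] [].
  - move=> a A lA _; rewrite (_ : A = set0) => [|].
      by rewrite cards0 => n0; apply: (avG set0); rewrite ?cards0 // => x y; rewrite inE.
    by apply/setP => x; rewrite inE; apply/negP => /lA[].
(* If [k.+1] colors fail for [G], then [k] colors split every avoiding configuration, since the
   blow-up of an unsplit one would yield a coloring of [G]. *)
apply: contraT => nG; suff: colorable k G.
  by move/(colorable_leq (leqnSn k)); rewrite (negPf nG).
apply: IHk => T0 X0 Y0 Xi Yi av; case: (splits_dec X0 Y0 k) => // nsp.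
have [] := @blowup_splits _ _ l r X0 Y0 li lr k nsp.
  apply: sp; [exact: blowup_X_inj|exact: blowup_Y_inj|exact: blowup_avoids].
move=> c cP; case/colorableP: nG; exists c => x y; rewrite lrE; exact: cP.
Qed.

(** * From colorings to splittings: projections to the staircase of minima *)

Lemma crossing_sym (V : Type) (l r : V -> nat) : symmetric (crossing l r).
Proof. by move=> x y; rewrite /crossing orbC. Qed.

Lemma crossing_irr (V : Type) (l r : V -> nat) : irreflexive (crossing l r).
Proof. by move=> x; rewrite /crossing ltnn. Qed.

Definition crossing_graph (V : finType) (l r : V -> nat) : sgraph :=
  SGraph (crossing_sym l r) (crossing_irr l r).

Lemma circle_graph_crossing (R : realType) (V : finType) (l r : V -> nat) :
  injective l -> injective r -> (forall x y, l x <> r y) ->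
  (forall x, l x < r x) -> circle_graph R (crossing_graph l r).
Proof. by move=> li ri lr ltlr; apply/circle_graphP; exists l, r. Qed.

(** A single arc is enough; it excludes [k = 0] and makes the extremal value positive. *)
Lemma circle_graph_not_0_colorable (R : realType) (n : nat) : 1 < n ->
  exists G, [/\ circle_graph R G, K_free n G & ~~ colorable 0 G].
Proof.
move=> n1; exists (@crossing_graph unit (fun=> 0) (fun=> 1)); split.
- by apply: circle_graph_crossing => // -[] [].
- case=> A An _; have := max_card (mem A).
  by rewrite An card_unit leqNgt n1.
- by apply/colorableP => -[c _]; case: (c tt).
Qed.

Section Shadow.
Variables (T : finType) (X Y : T -> nat).
Hypotheses (X_inj : injective X) (Y_inj : injective Y).

(** The left-to-right minimum reached by projecting [t] horizontally: the leftmost point that is not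
    above [t]. *)
Let lowest t := [arg min_(u < t | Y u <= Y t) X u].

Let lowestP t : Y (lowest t) <= Y t /\ forall u, Y u <= Y t -> X (lowest t) <= X u.
Proof. by rewrite /lowest; case: arg_minnP. Qed.

(* [t] is not a left-to-right minimum iff [X (lowest t) < X t]. *)
Let V := {t : T | X (lowest t) < X t}.

Let N := \max_t Y t.

Let leN t : Y t <= N. Proof. exact: leq_bigmax. Qed.

(* The left endpoint is the position of the leftmost point below [t], with ties
   broken by decreasing height. *)
Let l (v : V) := X (lowest (val v)) * N.+2 + (N.+1 - Y (val v)).
(** The offset [0] is smaller than all offsets in [l], so in a common block right endpoints come
    first and never equal left ones. *)
Let r (v : V) := X (val v) * N.+2 + 0.

(** A higher [t] has more points not above it, so its projection moves weakly to the left; the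
    offsets settle ties. *)
Let ltl x y : (l x < l y) = (Y (val y) < Y (val x)).
Proof.
rewrite ltn_block; try by have := leN (val x); have := leN (val y); lia.
have [hx mx] := lowestP (val x); have [hy my] := lowestP (val y).
have := leN (val x); have := leN (val y).
case: (ltnP (Y (val y)) (Y (val x))) => xy.
  by have := mx _ (leq_trans hy (ltnW xy)); lia.
by have := my _ (leq_trans hx xy); lia.
Qed.

Let ltlr x y : (l x < r y) = (X (lowest (val x)) < X (val y)).
Proof. by rewrite ltn_block ?ltn0 ?andbF ?orbF //; lia. Qed.

Let ltr x y : (r x < r y) = (X (val x) < X (val y)).
Proof. by rewrite ltn_block // andbF orbF. Qed.

Lemma splits_of_crossing_colorings (R : realType) (n k : nat) :
  0 < k -> 0 < #|T| -> avoids X Y n ->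
  (forall G, circle_graph R G -> K_free n G -> colorable k G) -> splits X Y k.
Proof.
move=> k0 /card_gt0P[t0 _] av col.
have [||c cP] := colorableP _ _ (col (crossing_graph l r) _ _).
- apply: circle_graph_crossing => [x y lxy|x y|x y|x].
  + apply/val_inj/Y_inj; have := ltl x y; have := ltl y x.
    by rewrite lxy ltnn; case: ltngtP.
  + move=> rxy; apply/val_inj/X_inj; have := ltr x y; have := ltr y x.
    by rewrite rxy ltnn; case: ltngtP.
  + have offK : N.+1 - Y (val x) < N.+2 by rewrite ltnS leq_subr.
    case/(block_inj offK (ltn0Sn _)) => _ /eqP.
    by rewrite subn_eq0 ltnNge leN.
  + by rewrite ltlr (valP x).
- case=> A An; rewrite /= => clA.
  have cross x y : x \in A -> y \in A -> X (val x) < X (val y) ->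
      Y (val y) < Y (val x) /\ X (lowest (val y)) < X (val x).
    move=> Ax Ay xy; have := clA _ _ Ax Ay; rewrite /crossing !ltl !ltlr !ltr.
    have -> : x != y by apply: contraTneq xy => ->; rewrite ltnn.
    move=> /(_ isT)/orP[/and3P[-> -> //]|/and3P[_ _]].
    by rewrite ltnNge ltnW.
  (* An empty clique means [n = 0], which avoidance at [t0] with the empty set forbids. *)
  case: (set_0Vmem A) => [A0|[x0 Ax0]].
    by apply: (av t0 set0); rewrite ?cards0 -?An ?A0 ?cards0 // => x; rewrite inE.
  (* A clique is a decreasing set, so its lowest element [y] is also its rightmost, and
     [lowest (val y)] is below and to the left of the whole clique. *)
  pose y := [arg min_(v < x0 in A) Y (val v)].
  have [Ay ymin] : y \in A /\ forall x, x \in A -> Y (val y) <= Y (val x).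
    by rewrite /y; case: arg_minnP.
  apply: (av (lowest (val y)) (val @: A)); last by rewrite card_imset //; apply: val_inj.
    move=> _ /imsetP[x Ax ->]; have yx := ymin _ Ax.
    have ltX : X (lowest (val y)) < X (val x).
      case: (ltngtP (X (val x)) (X (val y))) => [/(cross _ _ Ax Ay)[] //|xy|/X_inj ->].
        by have [] := cross _ _ Ay Ax xy; rewrite ltnNge yx.
      exact: (valP y).
    split=> //; have [le_y _] := lowestP (val y).
    rewrite ltn_neqAle (leq_trans le_y yx) andbT.
    by apply: contraTneq ltX => /Y_inj ->; rewrite ltnn.
  by move=> _ _ /imsetP[x Ax ->] /imsetP[z Az ->] /(cross _ _ Ax Az)[].
(* Left-to-right minima carry no arc and receive the color [0], available since [0 < k]. *)
pose col' t := if insub t is Some v then c v else Ordinal k0.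
(* As [x] is below [y] and [z], both project to [x] or further left; hence neither is a minimum, and
   their arcs cross. *)
exists col' => x y z /andP[xy yz] /andP[xz zy] _.
have low t : Y x <= Y t -> X (lowest t) <= X x by move=> xt; apply: (lowestP t).2.
have ly := low _ (ltnW (ltn_trans xz zy)); have lz := low _ (ltnW xz).
have Vy : X (lowest y) < X y by apply: leq_ltn_trans ly _.
have Vz : X (lowest z) < X z by apply: leq_ltn_trans lz (ltn_trans xy yz).
rewrite /col' !insubT; apply: cP.
by rewrite /= /crossing ltl ltlr ltr /= zy yz (leq_ltn_trans lz xy).
Qed.

End Shadow.

(** * Chromatic numbers and the equivalence *)

Lemma chromatic_number_leq (k : nat) (G : sgraph) :
  (chromatic_number G <= k) = colorable k G.
Proof.
rewrite /chromatic_number; case: ex_minnP => m colm minm.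
by apply/idP/idP => [mk|/minm //]; apply: colorable_leq colm.
Qed.

(** For [n = 1] and [k = 0] the equivalence fails: only the empty graph is [K_1]-free, and it needs
    no color, while decreasing permutations need one. So for [n = 1] the extremal values are [1] and
    [0]; for [n = 0] no graph is [K_0]-free and there is no largest chromatic number. *)
Theorem proposition3p20 (R : realType) (n : nat) :
  (forall k : nat, ~ (n = 1 /\ k = 0) ->
     (admits_splitting (Av (one_oplus (delta n)))
                       (multiset_mul [:: Av [:: 1; 3; 2]] k)
      <-> forall G : sgraph, circle_graph R G -> K_free n G -> colorable k G))
  /\
  (2 <= n ->
   forall f : nat,
     is_smallest (fun k => admits_splitting (Av (one_oplus (delta n)))
                             (multiset_mul [:: Av [:: 1; 3; 2]] k)) f
     <->
     is_largest (fun c => exists G : sgraph,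
                   [/\ circle_graph R G, K_free n G & chromatic_number G = c]) f).
Proof.
have main k : ~ (n = 1 /\ k = 0) ->
    admits_splitting (Av (one_oplus (delta n)))
                     (multiset_mul [:: Av [:: 1; 3; 2]] k)
    <-> forall G : sgraph, circle_graph R G -> K_free n G -> colorable k G.
  move=> nk; split=> [/admits_splittingP sp G /circle_graphP | col].
    move=> [l [r [li ri lr ltlr lrE]]] Gn.
    exact: (splits_colorable li ri lr ltlr lrE Gn sp).
  apply/admits_splittingP => T X Y Xi Yi av.
  case: (posnP #|T|) => [T0|T0]; first exact: splits_empty.
  apply: (splits_of_crossing_colorings Xi Yi _ T0 av col).
  (* For [k = 0], a nonempty configuration cannot avoid the pattern if [n = 0], and a single arc
     contradicts [col] if [1 < n]. *)
  case: (posnP k) => // k0; case: (ltngtP n 1) => [n0|n1|n1].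
  - have /card_gt0P[t _] := T0; exfalso.
    by apply: (av t set0) => [x|x y|]; rewrite ?inE // cards0; case: (n) n0.
  - have [G [Gc Gn]] := circle_graph_not_0_colorable R n1.
    by rewrite -k0 (col G Gc Gn).
  - by case: nk.
split=> // n2 f.
have {}main k : admits_splitting (Av (one_oplus (delta n)))
                     (multiset_mul [:: Av [:: 1; 3; 2]] k)
    <-> forall G : sgraph, circle_graph R G -> K_free n G ->
          chromatic_number G <= k.
  rewrite main; last by lia.
  by split=> H G Gc Gn; move: (H G Gc Gn); rewrite chromatic_number_leq.
split=> [[/main ub min_f] | [[G [Gc Gn Gf]] ub]]; last first.
  split; first by apply/main => H Hc Hn; apply: ub; exists H.
  by move=> j /main/(_ _ Gc Gn); rewrite Gf.
split; last by move=> _ [G [Gc Gn <-]]; apply: ub.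
(* The bound [f] is attained: otherwise [f.-1] colors would suffice, against minimality, as [G0]
   forces [0 < f]. *)
apply: boolp.contrapT => noG.
have [G0 [G0c G0n]] := circle_graph_not_0_colorable R n2.
rewrite -chromatic_number_leq -ltnNge => G0_pos.
suff /main/min_f : forall G : sgraph, circle_graph R G -> K_free n G ->
    chromatic_number G <= f.-1 by have := ub _ G0c G0n; lia.
move=> G Gc Gn; have := ub _ Gc Gn; rewrite leq_eqVlt => /predU1P[Gf|].
  by case: noG; exists G.
by move=> ?; lia.
Qed.
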